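(* The following three statements are equivalent: (1) $\mathfrak{d} = \mathfrak{c}$; (2) everywhere p-point-independent families exist generically, i.e. every independent family $I$ on $\omega$ with $|I| < \mathfrak{c}$ is contained in some everywhere p-point-independent family $I' \supseteq I$ on $\omega$; (3) p-point-independent families exist generically, i.e. every independent family $I$ on $\omega$ with $|I| < \mathfrak{c}$ is contained in some p-point-independent family $I' \supseteq I$ on $\omega$.
   Context: A ''function on $\omega$'' means a function $f:\omega\to\omega$. For $A \subseteq \omega$ let $A^0 = A$ and $A^1 = \omega\setminus A$. For a set $I$, $\mathrm{FF}(I)$ is the set of functions $h$ with finite domain $\mathrm{dom}(h)\subseteq I$ and values in $\{0,1\}$; for $h \in \mathrm{FF}(I)$ let $I^h = \bigcap\{A^{h(A)} : A \in \mathrm{dom}(h)\}$ (with $I^\emptyset=\omega$). An infinite family $I$ of subsets of $\omega$ is independent if $I^h \neq \emptyset$ for every $h \in \mathrm{FF}(I)$; all independent families considered are infinite. The envelope of $I$ is $\mathrm{ENV}(I) = \{I^h : h \in \mathrm{FF}(I)\}$. An independent family $I$ is p-point-independent if for every function $f$ on $\omega$ there is $E \in \mathrm{ENV}(I)$ such that $f\restriction E$ is finite-to-one or constant. It is everywhere p-point-independent if for every function $f$ on $\omega$ and every $h \in \mathrm{FF}(I)$ there is $k \in \mathrm{FF}(I)$ with $h \subseteq k$ such that $f \restriction I^k$ is finite-to-one or constant. $\mathfrak{c}$ is the cardinality of the set of functions on $\omega$. A function $f$ dominates $g$ if $f(n) > g(n)$ for all $n\in\omega$; $\mathfrak{d}$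 is the minimum cardinality of a family $F$ of functions on $\omega$ such that every function on $\omega$ is dominated by some member of $F$. *)

(* Defs.v *)
From mathcomp Require Import all_boot finmap.
From mathcomp Require Import boolp classical_sets functions cardinality.

Set Implicit Arguments.
Unset Strict Implicit.
Unset Printing Implicit Defensive.

Local Open Scope classical_set_scope.
Local Open Scope card_scope.

Definition card_lt (T U : Type) (A : set T) (B : set U) : Prop :=
  A #<= B /\ ~ (A #= B).

Definition continuum : set (nat -> nat) := [set: nat -> nat].

(* Strict domination everywhere, not just eventually. *)
Definition dominates (f g : nat -> nat) : Prop := forall n : nat, g n < f n.

Definition dominating (F : set (nat -> nat)) : Prop :=
  forall g : nat -> nat, exists2 f, F f & dominates f g.

(* Cardinals are represented by sets up to [#=]: the cardinal d is that of any
   dominating family that embeds into every dominating family. *)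
Definition min_dominating (F : set (nat -> nat)) : Prop :=
  dominating F /\ forall G, dominating G -> F #<= G.

Definition d_eq_c : Prop := exists2 F, min_dominating F & F #= continuum.

(* A^0 = A and A^1 = ~` A, with 0 = false and 1 = true. *)
Definition side (A : set nat) (b : bool) : set nat := if b then ~` A else A.

Definition FF (I : set (set nat)) : set {fmap set nat -> bool} :=
  [set h | [set` domf h] `<=` I].

(* I^h, which depends on h only; it is the whole of nat when h is empty. *)
Definition cell (h : {fmap set nat -> bool}) : set nat :=
  \bigcap_(A : domf h) side (val A) (h A).

Definition independent (I : set (set nat)) : Prop :=
  infinite_set I /\ forall h, FF I h -> cell h !=set0.

Definition ENV (I : set (set nat)) : set (set nat) := cell @` FF I.

Definition finite_to_one_on (E : set nat) (f : nat -> nat) : Prop :=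
  forall m : nat, finite_set (E `&` f @^-1` [set m]).

Definition constant_on (E : set nat) (f : nat -> nat) : Prop :=
  exists c : nat, forall n, E n -> f n = c.

Definition ppoint_independent (I : set (set nat)) : Prop :=
  independent I /\
  forall f : nat -> nat, exists2 E, ENV I E &
    finite_to_one_on E f \/ constant_on E f.

Definition extends (k h : {fmap set nat -> bool}) : Prop := k.[& domf h]%fmap = h.

Definition everywhere_ppoint_independent (I : set (set nat)) : Prop :=
  independent I /\
  forall (f : nat -> nat) h, FF I h ->
    exists k, [/\ FF I k, extends k h &
      finite_to_one_on (cell k) f \/ constant_on (cell k) f].

Definition exist_generically (P : set (set nat) -> Prop) : Prop :=
  forall I : set (set nat), independent I -> card_lt I continuum ->
    exists2 I', I `<=` I' & P I'.

(* Main.v *)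
Require Import Defs.
From mathcomp Require Import all_boot.
From mathcomp Require Import finmap.
From mathcomp Require Import boolp classical_sets functions cardinality wochoice.

(** If [d = c] and [J] is independent with [|J| < c], then for a given [f] and a
    given cell, the functions "least point of a smaller cell above [n]" are too
    few to be dominating. A function [g] that escapes them all cuts out a set on
    which [f] is finite-to-one and which meets every smaller cell, unless [f] is
    constant on such a set; glued to a set splitting all cells of [J], this
    gives a new member of the family. A recursion of length [c] treats all
    functions and all cells.

    Conversely, if a dominating [D] has fewer than [c] elements, take an
    independent family of sets lying, for every [g] in [D] and [m], infinitely
    often in the part of the plane above the graph of [g] and to the right of
    [m]. Each cell of an independent extension meets all these parts, so the
    first projection is neither constant nor finite-to-one on it. *)

Set Implicit Arguments.
Unset Strict Implicit.
Unset Printing Implicit Defensive.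

Local Open Scope classical_set_scope.
Local Open Scope card_scope.

(** * Cardinal arithmetic *)

Lemma inj_on_card_le (T U : Type) (A : set T) (B : set U) (f : T -> U) :
  (forall x, A x -> B (f x)) ->
  (forall x y, A x -> A y -> f x = f y -> x = y) -> A #<= B.
Proof.
move=> fAB fI; have fAE : f @` A #= A.
  by apply: inj_card_eq => x y /set_mem Ax /set_mem Ay; exact: fI.
rewrite -(card_le_eql fAE); apply: subset_card_le => _ [x Ax <-]; exact: fAB.
Qed.

Lemma card_le_inj (T : Type) (U : pointedType) (A : set T) (B : set U) :
  A #<= B -> exists f : T -> U, (forall x, A x -> B (f x)) /\
    (forall x y, A x -> A y -> f x = f y -> x = y).
Proof.
move=> /pcard_leP/injfunPex[f fAB fI]; exists f; split=> // x y Ax Ay.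
by apply: fI; exact: mem_set.
Qed.

(** A partial injection of [A] into [B] that is maximal by Zorn's lemma is total or onto, since
    otherwise one more pair could be added. *)
Lemma card_le_total (T U : pointedType) (A : set T) (B : set U) :
  A #<= B \/ B #<= A.
Proof.
pose P := [set R : set (T * U) | (forall p, R p -> A p.1 /\ B p.2) /\
  (forall p q, R p -> R q -> p.1 = q.1 <-> p.2 = q.2)].
have [|R [[RAB RI] Rmax]] := @Zorn_bigcup _ P.
  move=> F FP Ftot; split=> [p [R FR Rp]|p q [R FR Rp] [S FS Sq]].
    exact: (FP _ FR).1.
  by case: (Ftot R S FR FS) => sub; [apply: (FP _ FS).2|apply: (FP _ FR).2];
    rewrite //; exact: sub.
have [domA|] := pselect (forall x, A x -> exists y, R (x, y)).
  left.
  have /choice[f Hf] : forall x, exists y, A x -> R (x, y).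
    move=> x; have [/domA[y Rxy]|nA] := pselect (A x); first by exists y.
    by exists point.
  apply: (@inj_on_card_le _ _ _ _ f) => [x /Hf/RAB[]//|x y /Hf Rx /Hf Ry fxy].
  exact: (RI _ _ Rx Ry).2.
move=> /existsNP[x0 /not_implyP[Ax0 /forallNP Rx0]].
have [domB|] := pselect (forall y, B y -> exists x, R (x, y)).
  right.
  have /choice[f Hf] : forall y, exists x, B y -> R (x, y).
    move=> y; have [/domB[x Rxy]|nA] := pselect (B y); first by exists x.
    by exists point.
  apply: (@inj_on_card_le _ _ _ _ f) => [x /Hf/RAB[]//|x y /Hf Rx /Hf Ry fxy].
  exact: (RI _ _ Rx Ry).1.
move=> /existsNP[y0 /not_implyP[By0 /forallNP Ry0]].
case: (Rmax (R `|` [set (x0, y0)])).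
  split=> [|sub]; first exact: subsetUl.
  by apply: (Rx0 y0); apply: sub; right.
split=> [p [/RAB//|->//]|[a b] [c d] [Rp|[-> ->]] [Rq|[-> ->]] //=].
- exact: RI Rp Rq.
- split=> e; first by case: (Rx0 b); rewrite -e.
  by case: (Ry0 a); rewrite -e.
- split=> e; first by case: (Rx0 d); rewrite e.
  by case: (Ry0 c); rewrite e.
Qed.

(** Words code tuples and finite subsets alike, so that one absorption result, [seqs_card_le],
    yields the cardinal bounds below. *)
Definition seqs (T : eqType) (K : set T) : set (seq T) :=
  [set l | forall x, x \in l -> K x].

(* A maximal partial injection of the nonempty words over a subset A into A has
   A of full cardinality, since a copy of A outside A would absorb all the
   words over the union through an encoding by words over A. *)
Lemma seqs_card_le (T : pointedType) (K : set T) :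
  infinite_set K -> seqs K #<= K.
Proof.
move=> Kinf.
(* The alphabet is read off the graph: [x] belongs to it once the one-letter word [[:: x]] has a
   value. *)
pose al (G : set (seq T * T)) := [set x | exists y, G ([:: x], y)].
pose P := [set G : set (seq T * T) | [/\ al G `<=` K,
  forall l y, G (l, y) -> [/\ l <> [::], seqs (al G) l & al G y],
  forall l, l <> [::] -> seqs (al G) l -> exists y, G (l, y) &
  forall p q, G p -> G q -> p.1 = q.1 <-> p.2 = q.2]].
have [|G [[GK GV Gtot GI] Gmax]] := @Zorn_bigcup _ P.
  move=> F FP Ftot; split.
  - by move=> x [y [G FG Gx]]; have [+ _ _ _] := FP _ FG; apply; exists y.
  - move=> l y [G FG Gly]; have [_ /(_ _ _ Gly)[l0 lG [z yG]] _ _] := FP _ FG.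
    split=> // [x /lG[u Gu]|]; first by exists u, G.
    by exists z, G.
  - move=> l l0 lF.
    (* The finitely many letters of [l] already lie in the alphabet of one member of the chain. *)
    have [G FG Gl] : exists2 G, F G & seqs (al G) l.
      elim: l l0 lF => // x l IH _ lF.
      have [y [G FG Gx]] : al (\bigcup_(X in F) X) x by apply: lF; rewrite inE eqxx.
      have [l0|l0] := pselect (l = [::]).
        by exists G => //; rewrite l0 => z; rewrite inE => /eqP ->; exists y.
      have [|H FH Hl] := IH l0; first by move=> z zl; apply: lF; rewrite inE zl orbT.
      case: (Ftot _ _ FG FH) => sub.
        exists H => // z; rewrite inE => /predU1P[->|/Hl//]; exists y; exact: sub.
      exists G => // z; rewrite inE => /predU1P[->|/Hl[u Hu]]; first by exists y.
      by exists u; apply: sub.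
    by have [_ _ /(_ _ l0 Gl)[y Gy] _] := FP _ FG; exists y, G.
  - move=> p q [R FR Rp] [S FS Sq].
    case: (Ftot R S FR FS) => sub.
      by have [_ _ _ +] := FP _ FS; apply=> //; exact: sub.
    by have [_ _ _ +] := FP _ FR; apply=> //; exact: sub.
pose A := al G.
(* Maximality of [G]: no nonempty [B] outside [A] can receive, injectively, all the words over the
   union that are not words over [A]. *)
have key (B : set T) (g : seq T -> T) : B !=set0 -> B `<=` K ->
    (forall x, B x -> ~ A x) ->
    (forall l, seqs (A `|` B) l -> ~ seqs A l -> B (g l)) ->
    (forall l l', seqs (A `|` B) l -> seqs (A `|` B) l' -> ~ seqs A l ->
      ~ seqs A l' -> g l = g l' -> l = l') -> False.
  move=> [b0 Bb0] BK BA gB gI.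
  have nA (l : seq T) : ~ seqs A l -> l <> [::] by move=> + l0; rewrite l0; apply.
  pose H := G `|` [set p | [/\ seqs (A `|` B) p.1, ~ seqs A p.1 & g p.1 = p.2]].
  have alH : al H = A `|` B.
    apply/seteqP; split=> x.
      move=> [y [Gx|[/= + _ _]]]; first by left; exists y.
      by apply; rewrite inE.
    move=> [[y Gy]|Bx]; first by exists y; left.
    have xAB : seqs (A `|` B) [:: x] by move=> z; rewrite inE => /eqP ->; right.
    exists (g [:: x]); right; split=> //= /(_ x); rewrite inE eqxx => /(_ isT).
    exact: BA.
  apply: (Gmax H).
    split=> [|/(_ ([:: b0], g [:: b0]))sub]; first exact: subsetUl.
    apply: (BA b0 Bb0); exists (g [:: b0]); apply: sub; right.
    split=> //=; first by move=> z; rewrite inE => /eqP ->; right.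
    by move=> /(_ b0); rewrite inE eqxx => /(_ isT); exact: BA.
  split; rewrite ?alH.
  - by move=> x [/GK//|/BK].
  - move=> l y [/GV[l0 lA Ay]|/= [lAB lA <-]].
      by split=> //; [move=> x /lA; left|left].
    by split=> //; [exact: nA|right; exact: gB].
  - move=> l l0 lAB; have [/(Gtot _ l0)[y]|lA] := pselect (seqs A l).
      by exists y; left.
    by exists (g l); right.
  - move=> [l y] [l' y'] [Gl|/= [lAB lA ly]] [Gl'|/= [lAB' lA' ly']].
    + exact: GI.
    + split=> /= e; first by case: lA'; rewrite -e; have [] := GV _ _ Gl.
      have [_ _ Ay] := GV _ _ Gl.
      by case: (BA y); rewrite // e -ly'; exact: gB.
    + split=> /= e; first by case: lA; rewrite e; have [] := GV _ _ Gl'.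
      have [_ _ Ay] := GV _ _ Gl'.
      by case: (BA y'); rewrite // -e -ly; exact: gB.
    + split=> /= e; first by rewrite -ly -ly' e.
      by apply: gI => //; rewrite ly ly'.
(* If [A] were empty, a countable subset of [K] could take in its own finite words. *)
have [A0|/eqP/set0P[a Aa]] := pselect (A = set0).
  have /infiniteP/card_le_inj[e [eK eI]] := Kinf.
  pose B := range e.
  have /choice[d dP] : forall x, exists n, B x -> e n = x.
    move=> x; have [[n _ <-]|nB] := pselect (B x); first by exists n.
    by exists 0.
  have d_inj x y : B x -> B y -> d x = d y -> x = y.
    by move=> /dP {2}<- /dP {2}<- ->.
  have ABB l : seqs (A `|` B) l -> seqs B l by rewrite A0 set0U.
  exfalso; apply: (key B (fun l => e (choice.pickle (map d l)))).
  - by exists (e 0); apply: imageT.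
  - by move=> _ [n _ <-]; exact: eK.
  - by move=> x _; rewrite A0.
  - by move=> l _ _; apply: imageT.
  - move=> l l' /ABB lB /ABB lB' _ _.
    move=> /eI -/(_ I I) /(pcan_inj choice.pickleK).
    elim: l l' lB lB' => [|x l IH] [|y l'] // lB lB' [xy /IH ->].
    + by rewrite (d_inj x y) //; [apply: lB|apply: lB']; rewrite inE eqxx.
    + by move=> z zl; apply: lB; rewrite inE zl orbT.
    + by move=> z zl; apply: lB'; rewrite inE zl orbT.
have /choice[g gP] : forall l, exists y, l <> [::] -> seqs A l -> G (l, y).
  move=> l; have [[l0 lA]|nl] := pselect (l <> [::] /\ seqs A l).
    by have [y Gy] := Gtot _ l0 lA; exists y.
  by exists point => l0 lA; case: nl.
have gA l : l <> [::] -> seqs A l -> A (g l).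
  by move=> l0 lA; have [] := GV _ _ (gP l l0 lA).
have gI l l' : l <> [::] -> seqs A l -> l' <> [::] -> seqs A l' -> g l = g l' ->
    l = l'.
  by move=> l0 lA l0' lA' e; apply/(GI _ _ (gP l l0 lA) (gP l' l0' lA')).
have sA1 x : A x -> seqs A [:: x] by move=> Ax z; rewrite inE => /eqP ->.
have sA2 x y : A x -> A y -> seqs A [:: x; y].
  by move=> Ax Ay z; rewrite !inE => /orP[] /eqP ->.
(* Two distinct letters, to mark whether a letter comes from [A] or from [B]. *)
pose tag (c : bool) := if c then g [:: a] else g [:: a; a].
have tagA c : A (tag c).
  by case: c; apply: gA => //; [exact: sA1|exact: sA2].
have tagI : injective tag.
  have ne : g [:: a] <> g [:: a; a].
    move=> e; suff : [:: a] = [:: a; a] by [].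
    by apply: gI => //; [exact: sA1|exact: sA2].
  by move=> [] [] // => /esym.
have absorb (B : set T) (b : T -> T) : (forall x, B x -> A (b x)) ->
    (forall x y, B x -> B y -> b x = b y -> x = y) ->
    (forall x, B x -> ~ A x) ->
    exists h : seq T -> T, (forall l, seqs (A `|` B) l -> A (h l)) /\
     (forall l l', seqs (A `|` B) l -> seqs (A `|` B) l' -> h l = h l' -> l = l').
  move=> bA bI BA.
  pose c x : T * T := if `[< A x >] then (tag true, x) else (tag false, b x).
  have cA x : (A `|` B) x -> A (c x).1 /\ A (c x).2.
    rewrite /c; case: asboolP => Ax /= ABx.
      by split=> //; exact: (tagA true).
    by split; [exact: (tagA false)|apply: bA; case: ABx].
  have cI x y : (A `|` B) x -> (A `|` B) y -> c x = c y -> x = y.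
    rewrite /c; case: asboolP => Ax; case: asboolP => Ay ABx ABy.
    - by case.
    - by case=> /(@tagI true false).
    - by case=> /(@tagI false true).
    - by case=> /bI; apply; [case: ABx|case: ABy].
  (* Each letter becomes a tag and a letter of [A]; the leading [a] keeps the word nonempty, as [g]
     is controlled on nonempty words only. *)
  pose w l := a :: flatten [seq [:: (c x).1; (c x).2] | x <- l].
  have wA l : seqs (A `|` B) l -> seqs A (w l).
    move=> lAB z; rewrite inE => /predU1P[->//|/flattenP[s /mapP[x xl ->]]].
    by have [? ?] := cA _ (lAB _ xl); rewrite !inE => /orP[] /eqP ->.
  exists (g \o w); split=> [l lAB|l l' lAB lAB' gw].
    by apply: gA => //; exact: wA.
  have : w l = w l' by apply: gI => //; exact: wA.
  case; rewrite {gw}.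
  elim: l l' lAB lAB' => [|x l IH] [|y l'] // lB lB' [c1 c2 /IH ->].
  - rewrite (cI x y) //; [by apply: lB; rewrite inE eqxx| |].
      by apply: lB'; rewrite inE eqxx.
    by rewrite [c x]surjective_pairing c1 c2 -surjective_pairing.
  - by move=> z zl; apply: lB; rewrite inE zl orbT.
  - by move=> z zl; apply: lB'; rewrite inE zl orbT.
(* If the rest of [K] embeds into [A], then [A] absorbs all words over [K]; if [A] embeds into the
   rest, its image contradicts maximality. *)
case: (card_le_total (K `\` A) A) => [/card_le_inj[b [bA bI]]|/card_le_inj[b [bA bI]]].
  have [|h [hA hI]] := absorb (K `\` A) b bA bI; first by move=> x [].
  have KA l : seqs K l -> seqs (A `|` (K `\` A)) l.
    move=> lK x /lK Kx; have [Ax|Ax] := pselect (A x); first by left.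
    by right.
  apply: (@inj_on_card_le _ _ _ _ h) => [l /KA/hA/GK//|l l' /KA lK /KA].
  exact: hI.
exfalso.
pose B := b @` A.
have /choice[d dP] : forall x, exists y, B x -> A y /\ b y = x.
  move=> x; have [[y Ay <-]|nB] := pselect (B x); first by exists y.
  by exists a.
have [| |x [y /bA[_ By] <-]//|h [hA hI]] := absorb B d.
- by move=> x /dP[].
- by move=> x y /dP[_ {2}<-] /dP[_ {2}<-] ->.
apply: (key B (b \o h)).
- by exists (b a); exact: imageP.
- by move=> _ [y /bA[? _] <-].
- by move=> _ [y /bA[_ ?] <-].
- by move=> l /hA Al _; exact: imageP.
- by move=> l l' lAB lAB' _ _ /bI -/(_ (hA _ lAB) (hA _ lAB'))/hI; apply.
Qed.

Lemma pair_seqs_card_le (T : pointedType) (K : set T) : infinite_set K ->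
  (seqs K `*` seqs K) `*` [set: nat] #<= K.
Proof.
move=> Kinf; apply: (card_le_trans _ (seqs_card_le Kinf)).
have /infiniteP/card_le_inj[e [eK eI]] := Kinf.
(* The length of the first word is recorded so that the concatenation can be cut again. *)
apply: (@inj_on_card_le _ _ _ _
  (fun i : seq T * seq T * nat => e i.2 :: e (size i.1.1) :: i.1.1 ++ i.1.2)).
  move=> [[P N] M] [[/= PK NK] _] x; rewrite !inE mem_cat.
  by move=> /or4P[/eqP->|/eqP->|/PK|/NK] //; exact: eK.
move=> [[P N] M] [[P' N'] M'] _ _ /= [/(eI _ _ I I) -> /(eI _ _ I I) sz] /eqP.
by rewrite eqseq_cat // => /andP[/eqP-> /eqP->].
Qed.

(** The functions [phi] that choose a witness [v] for each [n], one per triple of [P], [N] and [M],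
    number at most the size of [K], hence are not dominating; [g] is a function that none of them
    dominates. *)
Lemma bounding_function (T : pointedType) (K : set T)
    (R : seq T -> seq T -> nat -> nat -> nat -> Prop) :
  (forall G, dominating G -> continuum #<= G) ->
  infinite_set K -> ~ (continuum #<= K) ->
  (forall P N M n, seqs K P -> seqs K N -> exists v, R P N M n v) ->
  exists g : nat -> nat, forall P N M, seqs K P -> seqs K N ->
    exists n v, R P N M n v /\ v <= g n.
Proof.
move=> domc Kinf Ksmall Rex.
have /choice[phi phiP] : forall i : seq T * seq T * nat, exists phi : nat -> nat,
    seqs K i.1.1 -> seqs K i.1.2 -> forall n, R i.1.1 i.1.2 i.2 n (phi n).
  move=> [[P N] M] /=.
  have [[PK NK]|nK] := pselect (seqs K P /\ seqs K N); last first.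
    by exists point => PK NK; case: nK.
  have /choice[phi] : forall n, exists v, R P N M n v by move=> n; exact: Rex.
  by exists phi.
pose G := phi @` ((seqs K `*` seqs K) `*` [set: nat]).
have : ~ dominating G.
  move=> /domc cG; apply: Ksmall; apply: (card_le_trans cG).
  by apply: (card_le_trans (card_image_le _ _)); exact: pair_seqs_card_le.
move=> /existsNP[g gP]; exists g => P N M PK NK.
have /existsNP[n] : ~ dominates (phi (P, N, M)) g.
  by move=> gdom; apply: gP; exists (phi (P, N, M)) => //; exists (P, N, M).
move=> /negP; rewrite -leqNgt => le; exists n, (phi (P, N, M) n); split=> //.
exact: (phiP (P, N, M)).
Qed.

(** The union is coded by words over the larger of [I] and [Z]: a member of [I] by one letter, any
    other element by two, for an index [z] and a position in [S z]. *)
Lemma not_continuum_le_bigcup (X V : pointedType) (I : set X) (Z : set V)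
    (S : V -> seq X) :
  infinite_set I -> ~ (continuum #<= I) -> ~ (continuum #<= Z) ->
  ~ (continuum #<= I `|` [set x | exists2 z, Z z & x \in S z]).
Proof.
move=> Iinf Ismall Zsmall.
have main (Y : pointedType) (L : set Y) : infinite_set L ->
    ~ (continuum #<= L) -> I #<= L -> Z #<= L ->
    ~ (continuum #<= I `|` [set x | exists2 z, Z z & x \in S z]).
  move=> Linf Lsmall /card_le_inj[i [iL iI]] /card_le_inj[j [jL jI]] le.
  apply: Lsmall; apply: (card_le_trans le).
  apply: (card_le_trans _ (seqs_card_le Linf)).
  have /infiniteP/card_le_inj[e [eL eI]] := Linf.
  have /choice[w wP] : forall x, exists z, (exists2 z, Z z & x \in S z) ->
      Z z /\ x \in S z.
    move=> x; have [[z Zz xz]|nx] := pselect (exists2 z, Z z & x \in S z).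
      by exists z.
    by exists point.
  pose f x := if `[< I x >] then [:: i x] else [:: j (w x); e (index x (S (w x)))].
  apply: (@inj_on_card_le _ _ _ _ f).
    move=> x; rewrite /f; case: asboolP => Ix xU y; rewrite !inE.
      by move=> /eqP->; exact: iL.
    case: xU => // /wP[Zw _] /orP[/eqP->|/eqP->]; [exact: jL|exact: eL].
  move=> x y; rewrite /f; case: asboolP => Ix; case: asboolP => Iy xU yU //.
    by case=> /iI; apply.
  case: xU yU => // /wP[Zx Sx] [//|/wP[Zy Sy]] [/jI wxy /eI].
  move=> /(_ Logic.I Logic.I); rewrite wxy // => /(congr1 (nth x (S (w y)))).
  by rewrite !nth_index // -wxy.
case: (card_le_total Z I) => [ZI|IZ]; first exact: (main _ I).
by apply: (main _ Z) => //; apply: contra_not Iinf; exact: card_le_finite.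
Qed.

(** [W] acts as the initial ordinal of the continuum: the whole order, or the segment below the
    first point that has continuum many predecessors. *)
Lemma ex_wellorder_continuum : exists (lt : (nat -> nat) -> (nat -> nat) -> Prop)
    (W : set (nat -> nat)),
  [/\ well_founded lt, (forall x y z, lt x y -> lt y z -> lt x z),
      (forall x y, [\/ lt x y, x = y | lt y x]),
      (continuum #<= W) &
      (forall x, W x -> ~ (continuum #<= [set y | lt y x]) /\
         (forall y, lt y x -> W y))].
Proof.
have [R Rwo] := well_ordering_principle (nat -> nat).
pose S := (nat -> nat).
have Rmin (A : set S) : A !=set0 -> exists2 z, A z & forall x, A x -> R z x.
  move=> [a Aa]; have [|z [[Az zmin] _]] := Rwo (mem A).
    by exists a; rewrite inE.
  by exists z; [exact/set_mem|move=> x Ax; apply: zmin; exact/mem_set].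
have RR : wo_chain R predT by move=> A _; exact: Rwo.
have Rtot x y : R x y \/ R y x.
  by apply/orP; apply: (wo_chainW RR).
have Rxx x : R x x by case: (Rtot x x).
have Ranti x y : R x y -> R y x -> x = y.
  by move=> Rxy Ryx; apply: (wo_chain_antisymmetric RR); rewrite ?Rxy.
have Rtr x y z : R x y -> R y z -> R x z.
  move=> Rxy Ryz.
  (* Transitivity is read off the least of the three points. *)
  have [|m mA mmin] := Rmin [set u | u = x \/ u = y \/ u = z]; first by exists x; left.
  case: mA => [mE|[mE|mE]]; rewrite {m}mE in mmin.
  - by apply: mmin; right; right.
  - by rewrite (Ranti x y) //; apply: mmin; left.
  - suff <- : y = z by [].
    by apply: Ranti => //; apply: mmin; right; left.
pose lt x y := R x y /\ x <> y.
have ltwf : well_founded lt.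
  move=> x; apply: contrapT => nx.
  have [|m nm mmin] := Rmin [set u | ~ Acc lt u]; first by exists x.
  apply: nm; constructor => y [Rym ym]; apply: contrapT => /mmin Rmy.
  by apply: ym; exact: Ranti.
have lttr x y z : lt x y -> lt y z -> lt x z.
  move=> [Rxy xy] [Ryz yz]; split; first exact: Rtr Rxy Ryz.
  by move=> xz; apply: xy; apply: Ranti => //; rewrite xz.
have lttot x y : [\/ lt x y, x = y | lt y x].
  have [->|xy] := pselect (x = y); first by constructor 2.
  by case: (Rtot x y) => ?; [constructor 1|constructor 3]; split=> // /esym.
pose big := [set x | continuum #<= [set y | lt y x]].
have [big0|/eqP/set0P/Rmin[m mbig mmin]] := pselect (big = set0).
  exists lt, setT; split=> // x _; split=> // bx.
  by suff : big x by rewrite big0.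
exists lt, [set y | lt y m]; split=> // x xm; split.
  move=> bx; case: xm => Rxm xm; apply: xm; apply: Ranti => //; exact: mmin.
by move=> y yx; exact: lttr yx xm.
Qed.

(** * Extending a small independent family by one set *)

(** The cell of a finite map, given by the list of sets taken as they are and the list of those
    complemented; lists are easy to join and filter. *)
Definition pcell (P N : seq (set nat)) : set nat :=
  [set p | (forall A, A \in P -> A p) /\ (forall A, A \in N -> ~ A p)].

Definition disj (T : eqType) (P N : seq T) : Prop :=
  forall x, x \in P -> x \in N -> False.

(** Independence apart from infinitude; see [independentP]. *)
Definition free (J : set (set nat)) : Prop :=
  forall P N, seqs J P -> seqs J N -> disj P N -> pcell P N !=set0.

Definition tame (E : set nat) (f : nat -> nat) : Prop :=
  finite_to_one_on E f \/ constant_on E f.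

Lemma tame_sub (E F : set nat) f : E `<=` F -> tame F f -> tame E f.
Proof.
move=> EF [Ff|[c cF]]; [left|right].
  by move=> m; apply: sub_finite_set (Ff m) => p [/EF].
by exists c => p /EF/cF.
Qed.

Lemma seqs_cons (T : eqType) (K : set T) x l :
  seqs K (x :: l) <-> K x /\ seqs K l.
Proof.
split=> [Kl|[Kx Kl] y]; last by rewrite inE => /predU1P[->|/Kl].
by split=> [|y yl]; apply: Kl; rewrite inE ?eqxx // yl orbT.
Qed.

Lemma seqs_cat (T : eqType) (K : set T) l l' :
  seqs K (l ++ l') <-> seqs K l /\ seqs K l'.
Proof.
split=> [Kl|[Kl Kl'] y]; last by rewrite mem_cat => /orP[/Kl|/Kl'].
by split=> y yl; apply: Kl; rewrite mem_cat yl ?orbT.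
Qed.

Lemma pcell_cat P P' N N' : pcell (P ++ P') (N ++ N') = pcell P N `&` pcell P' N'.
Proof.
apply/seteqP; split=> p; rewrite /pcell /=.
  move=> [Pp Np]; split; split=> A AP; [apply: Pp|apply: Np|apply: Pp|apply: Np];
    by rewrite mem_cat AP ?orbT.
by move=> [[Pp Np] [Pp' Np']]; split=> A; rewrite mem_cat => /orP[];
  [exact: Pp|exact: Pp'|exact: Np|exact: Np'].
Qed.

Lemma pcell_consl A P N : pcell (A :: P) N = A `&` pcell P N.
Proof.
apply/seteqP; split=> p; rewrite /pcell /=.
  move=> [Pp Np]; split; first by apply: Pp; rewrite inE eqxx.
  by split=> // B BP; apply: Pp; rewrite inE BP orbT.
by move=> [Ap [Pp Np]]; split=> // B; rewrite inE => /predU1P[->|/Pp].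
Qed.

Lemma pcell_consr A P N : pcell P (A :: N) = ~` A `&` pcell P N.
Proof.
apply/seteqP; split=> p; rewrite /pcell /=.
  move=> [Pp Np]; split; first by apply: Np; rewrite inE eqxx.
  by split=> // B BP; apply: Np; rewrite inE BP orbT.
by move=> [Ap [Pp Np]]; split=> // B; rewrite inE => /predU1P[->|/Np].
Qed.

Lemma pcell_sub (P P' N N' : seq (set nat)) :
  {subset P <= P'} -> {subset N <= N'} -> pcell P' N' `<=` pcell P N.
Proof. by move=> PP' NN' p [Pp Np]; split=> A => [/PP'/Pp|/NN'/Np]. Qed.

Lemma exists_fresh (T : choiceType) (J : set T) (F : seq T) :
  infinite_set J -> exists2 x, J x & x \notin F.
Proof.
move=> Jinf; apply: contrapT => /forall2NP nJ; apply: Jinf.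
apply: (sub_finite_set _ (finite_seq F)) => x Jx /=.
by case: (nJ x) => // /negP; rewrite negbK.
Qed.

(** Induction on [M]: a fresh member of [J] cuts the cell into two cells, each with a point from [M]
    on; these points differ, so one of them exceeds [M]. *)
Lemma pcell_unbounded (J : set (set nat)) (P N : seq (set nat)) (M : nat) :
  infinite_set J -> free J -> seqs J P -> seqs J N -> disj P N ->
  exists2 p, M <= p & pcell P N p.
Proof.
move=> Jinf Jfree; elim: M P N => [|M IH] P N JP JN PN.
  by have [p] := Jfree _ _ JP JN PN; exists p.
have [A JA] := exists_fresh (P ++ N) Jinf.
rewrite mem_cat negb_or => /andP[AP AN].
have [|||p Mp] := IH (A :: P) N.
- exact/seqs_cons.
- by [].
- by move=> B; rewrite inE => /predU1P[->|]; [apply/negP|exact: PN].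
rewrite pcell_consl => -[Ap PNp].
have [|||q Mq] := IH P (A :: N).
- by [].
- exact/seqs_cons.
- move=> B BP; rewrite inE => /predU1P[BA|]; last exact: PN.
  by move: AP; rewrite -BA BP.
rewrite pcell_consr => -[Aq PNq].
have [Mp'|pM] := ltnP M p; first by exists p.
have [Mq'|qM] := ltnP M q; first by exists q.
case: Aq; suff <- : p = q by [].
by apply: anti_leq; rewrite (leq_trans pM Mq) (leq_trans qM Mp).
Qed.

Section Step.
Variable J : set (set nat).
Hypotheses (domc : forall G, dominating G -> continuum #<= G)
  (Jinf : infinite_set J) (Jsmall : ~ (continuum #<= J)) (Jfree : free J).

Let valid P N := [/\ seqs J P, seqs J N & disj P N].

(* Shelah's argument for d <= i: fix a sequence of members [C n] of [J] and let
   [C n] decide on the points [p] for which [n] is least with [p < g n]. *)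
Lemma exists_splitter : exists Y : set nat, forall P N,
  seqs J P -> seqs J N -> disj P N ->
  (exists2 p, pcell P N p & Y p) /\ (exists2 p, pcell P N p & ~ Y p).
Proof.
have /infiniteP/card_le_inj[C [CJ CI]] := Jinf.
have late (F : seq (set nat)) : exists n0, forall i, n0 <= i -> C i \notin F.
  elim: F => [|A F [n nP]]; first by exists 0.
  have [[i Ai]|nA] := pselect (exists i, C i = A).
    exists (maxn n i.+1) => j; rewrite geq_max => /andP[nj ij].
    rewrite inE negb_or nP // andbT -Ai; apply/eqP => /CI -/(_ Logic.I Logic.I).
    by move=> ji; rewrite ji ltnn in ij.
  exists n => j nj; rewrite inE negb_or nP // andbT; apply/eqP => Aj.
  by apply: nA; exists j.
(* Below [v] the cell has points [p1] and [p2] from [M] on such that every [C i] with [i <= n] not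
   among [P] and [N] contains [p1] and omits [p2]. *)
pose R P N M n v := disj P N -> exists p1 p2,
  [/\ p1 < v, p2 < v, M <= p1 & M <= p2] /\ [/\ pcell P N p1, pcell P N p2 &
    forall i, i <= n -> C i \notin P ++ N -> C i p1 /\ ~ C i p2].
have [|g gP] := @bounding_function _ J R domc Jinf Jsmall.
  move=> P N M n JP JN.
  have [PN|nPN] := pselect (disj P N); last by exists 0 => PN; case: nPN.
  pose F := [seq A <- map C (iota 0 n.+1) | A \notin P ++ N].
  have FJ : seqs J F by move=> A; rewrite mem_filter => /andP[_ /mapP[i _ ->]]; exact: CJ.
  have Fn A : A \in F -> A \notin P /\ A \notin N.
    by rewrite mem_filter mem_cat negb_or => /andP[/andP[]].
  have [|||p1 Mp1] := @pcell_unbounded J (P ++ F) (N ++ [::]) M Jinf Jfree.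
  - exact/seqs_cat.
  - by rewrite cats0.
  - move=> A; rewrite cats0 mem_cat => /orP[|/Fn[_ AN]]; first exact: PN.
    exact/negP.
  rewrite pcell_cat => -[PNp1 [Fp1 _]].
  have [|||p2 Mp2] := @pcell_unbounded J (P ++ [::]) (N ++ F) M Jinf Jfree.
  - by rewrite cats0.
  - exact/seqs_cat.
  - move=> A; rewrite cats0 mem_cat => AP /orP[|/Fn[/negP]//]; exact: PN.
  rewrite pcell_cat => -[PNp2 [_ Fp2]].
  exists (maxn p1 p2).+1 => _; exists p1, p2; split.
    by rewrite !ltnS leq_maxl leq_maxr.
  split=> // i ile iPN; have iF : C i \in F.
    by rewrite mem_filter iPN map_f // mem_iota /= add0n ltnS.
  by split; [exact: Fp1|exact: Fp2].
pose Y := [set p | exists n, [/\ C n p, p < g n & forall i, i < n -> g i <= p]].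
exists Y => P N JP JN PN.
have [n0 n0P] := late (P ++ N).
(* With [M] the maximum of [g i] for [i < n0], the least [m] with [p < g m] is at least [n0] for
   both points, so [C m] is not named by the cell. *)
have [n [v [/(_ PN)[p1 [p2 [[p1v p2v Mp1 Mp2] [PN1 PN2 CP]]]] vg]]] :=
  gP P N (\max_(i < n0) g i) JP JN.
have rank p : p < v -> \max_(i < n0) g i <= p ->
    exists m, [/\ p < g m, forall i, i < m -> g i <= p, m <= n & n0 <= m].
  move=> pv Mp; have ex : exists m, p < g m by exists n; exact: leq_trans vg.
  case: (ex_minnP ex) => m pm mmin; exists m; split=> //.
  - by move=> i im; rewrite leqNgt; apply/negP => /mmin; rewrite leqNgt im.
  - by apply: mmin; exact: leq_trans vg.
  - rewrite leqNgt; apply/negP => mn0.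
    have := leq_bigmax (F := fun i : 'I_n0 => g i) (Ordinal mn0) => /= gm.
    by have := leq_trans pm (leq_trans gm Mp); rewrite ltnn.
split.
  exists p1 => //; have [m [p1m mmin mn n0m]] := rank p1 p1v Mp1.
  by exists m; split=> //; have [] := CP m mn (n0P _ n0m).
exists p2 => // -[m' [Cm' p2m' mmin']].
have [m [p2m mmin mn n0m]] := rank p2 p2v Mp2.
suff mm' : m = m' by have [_] := CP m mn (n0P _ n0m); rewrite mm'.
case: (ltngtP m m') => // mm'.
  by have := mmin' _ mm'; rewrite leqNgt p2m.
by have := mmin _ mm'; rewrite leqNgt p2m'.
Qed.

(** If below some cell one value of [f] is taken on [Y] in all smaller cells, [X] is its fibre.
    Otherwise any value can be avoided on [Y] by shrinking, so every smaller cell has, for each [n],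
    a point of [Y] with [n < f p], and [bounding_function] applies to these points. *)
Lemma exists_tame_trace (Y : set nat) (f : nat -> nat) P0 N0 :
  seqs J P0 -> seqs J N0 -> disj P0 N0 ->
  (forall P N, seqs J P -> seqs J N -> disj P N -> exists2 p, pcell P N p & Y p) ->
  exists P1 N1 X, [/\ valid P1 N1, {subset P0 <= P1}, {subset N0 <= N1}, tame X f &
    forall P N, valid P N -> {subset P1 <= P} -> {subset N1 <= N} ->
      exists2 p, pcell P N p & Y p /\ X p].
Proof.
move=> JP0 JN0 PN0 Yhit.
have [|nocst] := pselect (exists m P1 N1, [/\ valid P1 N1, {subset P0 <= P1},
    {subset N0 <= N1} & forall P N, valid P N -> {subset P1 <= P} ->
    {subset N1 <= N} -> exists2 p, pcell P N p & Y p /\ f p = m]).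
  move=> [m [P1 [N1 [vP1 sP sN hit]]]].
  by exists P1, N1, (f @^-1` [set m]); split=> //; right; exists m.
have avoid m P N : valid P N -> {subset P0 <= P} -> {subset N0 <= N} ->
    exists P' N', [/\ valid P' N', {subset P <= P'}, {subset N <= N'} &
      forall p, pcell P' N' p -> Y p -> f p <> m].
  move=> vP sP sN; apply: contrapT => nav; apply: nocst; exists m, P, N.
  split=> // P' N' vP' sP' sN'; apply: contrapT => nhit; apply: nav.
  by exists P', N'; split=> // p cp Yp fp; apply: nhit; exists p.
have above n P N : valid P N -> {subset P0 <= P} -> {subset N0 <= N} ->
    exists P' N', [/\ valid P' N', {subset P <= P'}, {subset N <= N'} &
      forall p, pcell P' N' p -> Y p -> n <= f p].
  move=> vP sP sN; elim: n => [|n [P1 [N1 [vP1 sP1 sN1 hn]]]].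
    by exists P, N; split.
  have [||P2 [N2 [vP2 sP2 sN2 hn2]]] := avoid n P1 N1 vP1.
  - by move=> A /sP/sP1.
  - by move=> A /sN/sN1.
  exists P2, N2; split=> //; [by move=> A /sP1/sP2|by move=> A /sN1/sN2|].
  move=> p cp Yp; rewrite ltn_neqAle hn //; last exact: pcell_sub cp.
  by rewrite andbT; apply/eqP => /esym; exact: hn2.
pose R P N (M : nat) n v := disj P N -> {subset P0 <= P} -> {subset N0 <= N} ->
  exists p, [/\ p < v, pcell P N p, Y p & n < f p].
have [|g gP] := @bounding_function _ J R domc Jinf Jsmall.
  move=> P N M n JP JN.
  have [[PN sP sN]|nv] := pselect [/\ disj P N, {subset P0 <= P} & {subset N0 <= N}];
    last by exists 0 => PN sP sN; case: nv.
  have [P1 [N1 [[JP1 JN1 PN1] sP1 sN1 hn]]] :=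
    above n.+1 P N (And3 JP JN PN) sP sN.
  have [p cp Yp] := Yhit P1 N1 JP1 JN1 PN1.
  exists p.+1 => _ _ _; exists p; split=> //; first exact: pcell_sub cp.
  exact: hn.
(* A point of this set with [f p = m] lies below [g n] for some [n < m], so every fibre is
   finite. *)
exists P0, N0, [set p | exists n, n < f p /\ p < g n]; split=> //.
  left=> m; apply: (sub_finite_set _ (finite_II (\max_(i < m) g i))) => p.
  move=> [[n [nf pg]] /= fp]; rewrite fp in nf.
  exact: leq_trans pg (leq_bigmax (F := fun i : 'I_m => g i) (Ordinal nf)).
move=> P N [JP JN PN] sP sN.
have [n [v [/(_ PN sP sN)[p [pv cp Yp nf]] vg]]] := gP P N 0 JP JN.
by exists p => //; split=> //; exists n; split=> //; exact: leq_trans vg.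
Qed.

(** The new set is [Y] cut down to [X] inside the cell of [P1] and [N1], and [Y] outside. It still
    splits all cells of [J], and its part in that cell lies in [X], where [f] is tame. *)
Lemma exists_tame_extension (f : nat -> nat) P0 N0 :
  seqs J P0 -> seqs J N0 -> disj P0 N0 ->
  exists A P N, [/\ free (J `|` [set A]), seqs (J `|` [set A]) P,
    seqs (J `|` [set A]) N, disj P N &
    [/\ {subset P0 <= P}, {subset N0 <= N} & tame (pcell P N) f]].
Proof.
move=> JP0 JN0 PN0.
have [Y Ysplit] := exists_splitter.
have [|P1 [N1 [X [[JP1 JN1 PN1] sP sN Xtame hit]]]] :=
    @exists_tame_trace Y f P0 N0 JP0 JN0 PN0.
  by move=> P N JP JN PN; have [] := Ysplit P N JP JN PN.
pose A := (X `&` Y `&` pcell P1 N1) `|` (Y `\` pcell P1 N1).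
have Asplit P N : seqs J P -> seqs J N -> disj P N ->
    (exists2 p, pcell P N p & A p) /\ (exists2 p, pcell P N p & ~ A p).
  move=> JP JN PN; have [[p cp Yp] [q cq Yq]] := Ysplit P N JP JN PN.
  split; last by exists q => // -[[[_ ?] _]|[? _]].
  have [d|nd] := pselect (disj (P ++ P1) (N ++ N1)).
    have [|||r cr [Yr Xr]] := hit (P ++ P1) (N ++ N1).
    - by split=> //; exact/seqs_cat.
    - by move=> B BP; rewrite mem_cat BP orbT.
    - by move=> B BP; rewrite mem_cat BP orbT.
    by rewrite pcell_cat in cr; case: cr => cr cr1; exists r => //; left.
  (* Contradictory lists have disjoint cells, so [p] lies outside the cell of [P1] and [N1], where
     [A] is [Y]. *)
  exists p => //; right; split=> // cp1; apply: nd => B BP BN.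
  have [hP hN] : pcell (P ++ P1) (N ++ N1) p by rewrite pcell_cat.
  by case: (hN B BN); exact: hP.
(* A member of [J] cannot split its own cell. *)
have AJ : ~ J A.
  move=> JA; have [| | |_ [p [pA _]]] := Asplit [:: A] [::].
  - exact/seqs_cons.
  - by [].
  - by [].
  by apply; apply: pA; rewrite inE.
have JJA : J `<=` J `|` [set A] by move=> B JB; left.
have seqsJA l : seqs J l -> seqs (J `|` [set A]) l by move=> Jl B /Jl; left.
exists A, (A :: P1), N1; split.
- move=> P N JP JN PN.
  pose rm l := [seq B <- l | B != A].
  have rmJ l : seqs (J `|` [set A]) l -> seqs J (rm l).
    by move=> Jl B; rewrite mem_filter => /andP[/eqP BA /Jl[//|/BA]].
  have rmd : disj (rm P) (rm N).
    by move=> B; rewrite !mem_filter => /andP[_ BP] /andP[_]; exact: PN.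
  have [[p [Pp Np] Ap] [q [Pq Nq] Aq]] := Asplit _ _ (rmJ _ JP) (rmJ _ JN) rmd.
  have [AN|AN] := boolP (A \in N).
    exists q; split=> B Bl.
      apply: Pq; rewrite mem_filter Bl andbT; apply/eqP => BA.
      by apply: (PN A) => //; rewrite -BA.
    by have [->//|BA] := eqVneq B A; apply: Nq; rewrite mem_filter BA.
  exists p; split=> B Bl.
    by have [->//|BA] := eqVneq B A; apply: Pp; rewrite mem_filter BA.
  apply: Np; rewrite mem_filter Bl andbT; apply/eqP => BA.
  by rewrite -BA Bl in AN.
- by apply/seqs_cons; split; [right|exact: seqsJA].
- exact: seqsJA.
- move=> B; rewrite inE => /predU1P[->|]; last exact: PN1.
  by move=> /JN1.
- split=> //; first by move=> B /sP BP; rewrite inE BP orbT.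
  apply: tame_sub Xtame => p; rewrite pcell_consl => -[[[[]]|[]]] //.
Qed.

End Step.

(** * From finite maps to pairs of finite lists *)

(** The value [false] selects the set itself, hence the positive list. *)
Definition pos (h : {fmap set nat -> bool}) : seq (set nat) :=
  [seq A <- domf h | h.[? A]%fmap == Some false].

Definition neg (h : {fmap set nat -> bool}) : seq (set nat) :=
  [seq A <- domf h | h.[? A]%fmap == Some true].

Definition fmap_of (P N : seq (set nat)) : {fmap set nat -> bool} :=
  [fmap A : [fset B in P ++ N]%fset => val A \in N]%fmap.

Lemma mem_pos h A : (A \in pos h) = (h.[? A]%fmap == Some false).
Proof.
by rewrite mem_filter; case: fndP => [kf|]; rewrite ?andbT // => /negPf->.
Qed.

Lemma mem_neg h A : (A \in neg h) = (h.[? A]%fmap == Some true).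
Proof.
by rewrite mem_filter; case: fndP => [kf|]; rewrite ?andbT // => /negPf->.
Qed.

Lemma disj_pos_neg h : disj (pos h) (neg h).
Proof. by move=> A; rewrite mem_pos mem_neg => /eqP->. Qed.

Lemma cellE h : cell h = pcell (pos h) (neg h).
Proof.
apply/seteqP; split=> p hp.
  have side_at A b : h.[? A]%fmap = Some b -> side A b p.
    by case: fndP => // kf [<-]; have := hp [` kf]%fset Logic.I.
  by split=> A; rewrite ?mem_pos ?mem_neg => /eqP/side_at.
case: hp => Pp Np [A kA] _; rewrite /side /=.
case hA: (h _).
  by apply: Np; rewrite mem_neg in_fnd hA.
by apply: Pp; rewrite mem_pos in_fnd hA.
Qed.

Lemma FF_lists (I : set (set nat)) h : FF I h ->
  seqs I (pos h) /\ seqs I (neg h).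
Proof. by move=> hI; split=> A; rewrite mem_filter => /andP[_ /hI]. Qed.

Lemma fnd_fmap_of P N A : (fmap_of P N).[? A]%fmap =
  if A \in P ++ N then Some (A \in N) else None.
Proof.
case: fndP => [kf|kf].
  by rewrite ffunE /=; move: kf; rewrite /= !inE mem_cat => ->.
by move: kf; rewrite /= !inE mem_cat => /negPf->.
Qed.

Lemma pos_fmap_of P N : disj P N -> pos (fmap_of P N) =i P.
Proof.
move=> PN A; rewrite mem_pos fnd_fmap_of mem_cat.
have [AP|] := boolP (A \in P); have [AN|] := boolP (A \in N) => //.
by case: (PN A).
Qed.

Lemma neg_fmap_of P N : neg (fmap_of P N) =i N.
Proof.
move=> A; rewrite mem_neg fnd_fmap_of mem_cat.
by case: (A \in P); case: (A \in N).
Qed.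

Lemma cell_fmap_of P N : disj P N -> cell (fmap_of P N) = pcell P N.
Proof.
move=> PN; rewrite cellE; apply/seteqP.
by split; apply: pcell_sub => A; rewrite ?pos_fmap_of // ?neg_fmap_of.
Qed.

Lemma FF_fmap_of (I : set (set nat)) P N : seqs I P -> seqs I N ->
  FF I (fmap_of P N).
Proof. by move=> IP IN A; rewrite /= !inE => /orP[/IP|/IN]. Qed.

Lemma extends_fmap_of P N h : disj P N -> {subset pos h <= P} ->
  {subset neg h <= N} -> extends (fmap_of P N) h.
Proof.
move=> PN sP sN; apply/fmapP => A; rewrite fnd_restrict.
case: ifP => [kA|/negbT kA]; last by rewrite not_fnd.
case hA: h.[? A]%fmap => [[]|]; last by move: kA; rewrite -fndSome hA.
  have AN : A \in N by apply: sN; rewrite mem_neg hA.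
  by rewrite fnd_fmap_of mem_cat AN orbT.
have AP : A \in P by apply: sP; rewrite mem_pos hA.
rewrite fnd_fmap_of mem_cat AP; congr Some; apply/negP; exact: PN.
Qed.

Lemma independentP I : independent I <-> infinite_set I /\ free I.
Proof.
split=> -[Iinf Ifree]; split=> //.
  move=> P N IP IN PN; rewrite -cell_fmap_of //; apply: Ifree; exact: FF_fmap_of.
move=> h /FF_lists[hP hN]; rewrite cellE; apply: Ifree => //; exact: disj_pos_neg.
Qed.

Lemma free_sub (J K : set (set nat)) : J `<=` K -> free K -> free J.
Proof. by move=> JK Kfree P N JP JN; apply: Kfree => A => [/JP/JK|/JN/JK]. Qed.

Lemma card_lt_continuum (T : Type) (A : set T) :
  card_lt A continuum -> ~ (continuum #<= A).
Proof. by move=> [AleC AneC] CleA; apply: AneC; rewrite card_eq_le AleC CleA. Qed.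

Lemma infinite_continuum : infinite_set continuum.
Proof.
apply/infiniteP; apply: (@inj_on_card_le _ _ _ _ (fun n _ => n)) => // m n _ _.
by move=> /(congr1 (@^~ 0)).
Qed.

(** A request: the cell with these two lists has to be shrunk until the function is tame on it. *)
Definition task : Type := (nat -> nat) * (seq (set nat) * seq (set nat)).

Lemma task_card_le : [set: task] #<= continuum.
Proof.
apply: (card_le_trans _ (seqs_card_le infinite_continuum)).
pose chi (A : set nat) (n : nat) : nat := `[< A n >].
have chiI : injective chi.
  move=> A B AB; apply/seteqP; split=> n.
    by move=> /asboolT An; have := congr1 (@^~ n) AB; rewrite /chi An;
      case: asboolP.
  by move=> /asboolT Bn; have := congr1 (@^~ n) AB; rewrite /chi Bn;
    case: asboolP.
(* Sets enter through their characteristic functions, and the length of the first list, as a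
   constant function, shows where to cut. *)
apply: (@inj_on_card_le _ _ _ _ (fun x : task =>
  x.1 :: (fun=> size x.2.1) :: map chi x.2.1 ++ map chi x.2.2)) => //.
move=> [f [P N]] [f' [P' N']] _ _ /= [-> /(congr1 (@^~ 0)) sz] /eqP.
rewrite eqseq_cat ?size_map // => /andP[/eqP/(inj_map chiI)-> /eqP].
by move=> /(inj_map chiI)->.
Qed.

(** * The recursion *)

Section Recursion.
Hypothesis domc : forall G, dominating G -> continuum #<= G.

(** Tasks are enumerated before the family is known and may name sets outside [J]. The list [S] may
    bring these in, on condition that freeness survives, so that meeting each task once suffices. *)
Definition solves (J : set (set nat)) (x : task) (S : seq (set nat)) : Prop :=
  free (J `|` [set` S]) /\
  (disj x.2.1 x.2.2 -> free (J `|` [set` x.2.1 ++ x.2.2]) ->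
   exists P N, [/\ seqs (J `|` [set` S]) P, seqs (J `|` [set` S]) N, disj P N &
     [/\ {subset x.2.1 <= P}, {subset x.2.2 <= N} & tame (pcell P N) x.1]]).

Lemma exists_solution (J : set (set nat)) (x : task) :
  infinite_set J -> ~ (continuum #<= J) -> free J -> exists S, solves J x S.
Proof.
case: x => f [P N] Jinf Jsmall Jfree; rewrite /solves /=.
pose K := J `|` [set` P ++ N].
have [[PN Kfree]|nPN] := pselect (disj P N /\ free K); last first.
  (* Nothing is added if the request is contradictory or would spoil freeness. *)
  exists [::]; split=> [|PN Kfree]; last by case: nPN.
  by apply: free_sub Jfree => A [].
have Kinf : infinite_set K by apply: (sub_infinite_set _ Jinf) => A; left.
have Ksmall : ~ (continuum #<= K).
  (* A finite list is a union over the single index [0]. *)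
  have KE : K = J `|` [set A | exists2 z : nat, [set 0] z & A \in P ++ N].
    apply/seteqP; split=> A [JA|]; [by left|by right; exists 0|by left|].
    by move=> [_ _ ?]; right.
  rewrite KE; apply: (not_continuum_le_bigcup (S := fun=> P ++ N)) => //.
  by move=> /card_le_finite/(_ (finite_set1 _))/infinite_continuum.
have [||A [P' [N' [free' KP' KN' PN' [sP sN ftame]]]]] :=
    @exists_tame_extension K domc Kinf Ksmall Kfree f P N _ _ PN.
- by move=> A AP; right; rewrite /= mem_cat AP.
- by move=> A AN; right; rewrite /= mem_cat AN orbT.
have KAE : K `|` [set A] = J `|` [set` A :: P ++ N].
  apply/seteqP; split=> B.
    move=> [[JB|/= BPN]|->]; [by left| |]; right; rewrite /= inE ?eqxx //.
    by rewrite BPN orbT.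
  move=> [JB|/=]; first by left; left.
  by rewrite inE => /predU1P[->|]; [right|left; right].
by exists (A :: P ++ N); rewrite -KAE; split=> // _ _; exists P', N'.
Qed.

(** Stage [w] of a recursion along [W] adds a finite list solving the task [tau w]. The family
    before it is small, as a small segment of [W] has contributed only finite lists. *)
Lemma exists_everywhere_ppoint (I : set (set nat)) :
  independent I -> ~ (continuum #<= I) ->
  exists2 I', I `<=` I' & everywhere_ppoint_independent I'.
Proof.
move=> /independentP[Iinf Ifree] Ismall.
have [lt [W [wf lttr lttot cW Wseg]]] := ex_wellorder_continuum.
have [tau tauP] : exists tau : (nat -> nat) -> task,
    forall x, exists2 w, W w & tau w = x.
  have /card_le_inj[i [iW iI]] := card_le_trans task_card_le cW.
  have /choice[tau tauP] : forall w, exists x, forall y, w = i y -> x = y.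
    move=> w; have [[x ->]|nw] := pselect (exists x, w = i x).
      by exists x => y /iI; apply.
    by exists (id, ([::], [::])) => y wy; case: nw; exists y.
  by exists tau => x; exists (i x); [exact: iW|exact: tauP].
have /choice[step stepP] : forall Jx : set (set nat) * task, exists S,
    infinite_set Jx.1 -> ~ (continuum #<= Jx.1) -> free Jx.1 ->
    solves Jx.1 Jx.2 S.
  move=> [J x] /=.
  have [[Jinf Jsmall Jfree]|nJ] :=
    pselect [/\ infinite_set J, ~ (continuum #<= J) & free J].
    by have [S] := exists_solution x Jinf Jsmall Jfree; exists S.
  by exists [::] => Jinf Jsmall Jfree; case: nJ.
pose F w (rec : forall y, lt y w -> seq (set nat)) :=
  step (I `|` [set A | exists y (yw : lt y w), A \in rec y yw], tau w).
pose S := Fix wf (fun=> seq (set nat)) F.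
(* [D (seg w)] will be the family before stage [w], [U w] the one after it, and [D W] the final
   one. *)
pose D (Z : set (nat -> nat)) := I `|` [set A | exists2 y, Z y & A \in S y].
pose seg w := [set y | lt y w].
have SE w : S w = step (D (seg w), tau w).
  rewrite /S Fix_eq => [|x f g fg]; last first.
    rewrite /F; congr (step (_ `|` _, _)); apply/seteqP; split=> A [y [yx]];
    by exists y, yx; rewrite ?fg // -fg.
  rewrite /F -/S; congr (step (_ `|` _, _)).
  by apply/seteqP; split=> A [y]; [move=> []|]; exists y.
pose U w := D (seg w) `|` [set` S w].
have Umono y w : lt y w -> U y `<=` U w.
  move=> yw A [[IA|[z zy Az]]|Ay]; left; [by left| |]; right.
    by exists z => //; exact: lttr yw.
  by exists y.
(* The order is linear, so finitely many members lie in [I] or in the family after a single stage;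
   freeness thus passes to unions. *)
have cover Z l : seqs (D Z) l -> seqs I l \/ exists2 y, Z y & seqs (U y) l.
  have IU y l' : seqs I l' -> seqs (U y) l' by move=> Il A /Il; left; left.
  elim: l => [|A l IH]; first by left.
  move=> /seqs_cons[DA /IH[Il|[y Zy Ul]]].
    case: DA => [IA|[y Zy Ay]]; first by left; apply/seqs_cons.
    by right; exists y => //; apply/seqs_cons; split; [right|exact: IU].
  case: DA => [IA|[z Zz Az]]; right.
    by exists y => //; apply/seqs_cons; split=> //; left; left.
  case: (lttot y z) => yz.
  - exists z => //; apply/seqs_cons; split; first by right.
    by move=> B /Ul; exact: Umono.
  - by exists y => //; apply/seqs_cons; split=> //; rewrite yz; right.
  - exists y => //; apply/seqs_cons; split=> //.
    by apply: (Umono _ _ yz); right.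
have freeD Z : (forall y, Z y -> free (U y)) -> free (D Z).
  move=> Zfree P N DP DN PN.
  have /cover[] : seqs (D Z) (P ++ N) by apply/seqs_cat.
    by move=> /seqs_cat[IP IN]; exact: Ifree.
  by move=> [y Zy /seqs_cat[UP UN]]; exact: (Zfree y).
have Dinf Z : infinite_set (D Z) by apply: (sub_infinite_set _ Iinf) => A; left.
have sol w : W w -> free (D (seg w)) -> solves (D (seg w)) (tau w) (S w).
  move=> Ww wfree; rewrite SE; apply: (stepP (D (seg w), tau w)) => //=.
  by apply: not_continuum_le_bigcup => //; have [] := Wseg w Ww.
have Ufree w : W w -> free (U w).
  elim/(well_founded_ind wf): w => w IH Ww; apply: (sol w Ww _).1.
  by apply: freeD => y yw; apply: IH => //; have [_] := Wseg w Ww; exact.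
have Wfree : free (D W) by exact: freeD.
have UW w : W w -> U w `<=` D W.
  move=> Ww A [[IA|[z zw Az]]|Aw]; [by left| |by right; exists w].
  by right; exists z => //; have [_] := Wseg w Ww; exact.
exists (D W); first by move=> A; left.
split; first by apply/independentP.
move=> f h /FF_lists[hP hN].
have [w Ww tauw] := tauP (f, (pos h, neg h)).
have wfree : free (D (seg w)).
  by apply: free_sub Wfree => A Aw; apply: (UW w Ww); left.
(* The sets named by [h] belong to [D W], which is free, so bringing them in at stage [w] is
   harmless and the request is granted. *)
have [_] := sol w Ww wfree; rewrite tauw /=.
case=> [||P [N [UP UN PN [sP sN ftame]]]].
- exact: disj_pos_neg.
- apply: free_sub Wfree => A [Aw|/=]; first by apply: (UW w Ww); left.
  by rewrite mem_cat => /orP[/hP|/hN].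
exists (fmap_of P N); split.
- by apply: FF_fmap_of => A => [/UP/(UW w Ww)|/UN/(UW w Ww)].
- exact: extends_fmap_of.
- by rewrite cell_fmap_of.
Qed.

End Recursion.

Lemma everywhere_ppoint I :
  everywhere_ppoint_independent I -> ppoint_independent I.
Proof.
move=> [Iind Itame]; split=> // f.
have [|k [Ik _ ktame]] := Itame f [fmap]%fmap; first by move=> A; rewrite /= inE.
by exists (cell k) => //; exists k.
Qed.

(** * A small family without p-point-independent extensions *)

(** Diagonalization: a member dominating the diagonal of an enumeration of [D] would exceed itself
    at its own index. *)
Lemma dominating_infinite D : dominating D -> infinite_set D.
Proof.
move=> Ddom /finite_set_countable Dcount.
have /card_le_inj[i [_ iI]] : D #<= [set: nat] by [].
have /choice[e eP] : forall n, exists f, forall g, D g -> i g = n -> f = g.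
  move=> n; have [[g Dg <-]|nn] := pselect (exists2 g, D g & i g = n).
    by exists g => g' Dg' /esym; exact: iI.
  by exists id => g Dg gn; case: nn; exists g.
have [f Df /(_ (i f))] := Ddom (fun n => e n n).
by rewrite (eP (i f) f) // ltnn.
Qed.

(** [w] picks a place where two distinct functions differ; [n] exceeds these places for all pairs
    from [l]. *)
Lemma mkseq_separates (l : seq (nat -> nat)) :
  exists n, forall g g', g \in l -> g' \in l -> mkseq g n = mkseq g' n -> g = g'.
Proof.
have /choice[w wP] : forall gg : (nat -> nat) * (nat -> nat),
    exists k, gg.1 <> gg.2 -> gg.1 k <> gg.2 k.
  move=> [g g'] /=; have [->|ne] := pselect (g = g'); first by exists 0.
  apply: contrapT => /forallNP nk; apply: ne; apply/funext => k.
  by apply: contrapT => gk; apply: (nk k).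
exists (\max_(g <- l) \max_(g' <- l) (w (g, g')).+1) => g g' gl g'l e.
apply: contrapT => /(wP (g, g')) /=; apply.
have wn : w (g, g') < \max_(g <- l) \max_(g' <- l) (w (g, g')).+1.
  pose row g := \max_(g' <- l) (w (g, g')).+1.
  have le_row : w (g, g') < row g by exact: (leq_bigmax_seq (F := fun g' => (w (g, g')).+1)).
  by apply: (leq_trans le_row); exact: (leq_bigmax_seq (F := row)).
by have := congr1 (nth 0 ^~ (w (g, g'))) e; rewrite !nth_mkseq.
Qed.

Section HighSets.

(** Hausdorff's construction of large independent families, placed over the plane: a point has a
    column, a length, a height and a finite list of triples, which names the restrictions of
    functions to that length that it accepts. *)
Let code : Type := nat * (nat * (nat * seq (seq nat * nat * nat))).

Definition enc (x : code) : nat := choice.pickle x.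
Definition dec (p : nat) : code := odflt (0, (0, (0, [::]))) (choice.unpickle p).

Lemma encK : cancel enc dec.
Proof. by move=> x; rewrite /dec choice.pickleK. Qed.

Definition column (p : nat) : nat := (dec p).1.
Definition height (p : nat) : nat := (dec p).2.2.1.

(* [i] only serves to produce infinitely many independent copies. *)
Definition high_set (g : nat -> nat) (m i : nat) : set nat :=
  [set p | [/\ m <= column p, g (column p) <= height p &
    (mkseq g (dec p).2.1, m, i) \in (dec p).2.2.2]].

Definition high_sets (D : set (nat -> nat)) : set (set nat) :=
  [set A | exists g m i, D g /\ A = high_set g m i].

Lemma high_set_inj g m i i' : high_set g m i = high_set g m i' -> i = i'.
Proof.
(* The list of this point names the index [i] only. *)
pose p := enc (m, (0, (g m, [:: (mkseq g 0, m, i)]))).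
move=> /seteqP[/(_ p) + _]; rewrite /high_set /column /height /= encK /=.
case; first by split=> //; rewrite inE.
by move=> _ _; rewrite inE => /eqP[->].
Qed.

Lemma high_sets_of_infinite g m : infinite_set (range (high_set g m)).
Proof.
apply/infiniteP; apply: (@inj_on_card_le _ _ _ _ (high_set g m)).
  by move=> i _; exact: imageT.
by move=> i i' _ _; exact: high_set_inj.
Qed.

(** The point has a column [a] not left of any bound [m], a height [t] not below any graph involved,
    and the list of the triples of [P]. The length [n] separates the functions, so no member of [N]
    finds its triple there. *)
Lemma high_sets_free D : free (high_sets D).
Proof.
move=> P N DP DN PN.
have /choice[c cP] : forall A, exists c : (nat -> nat) * nat * nat,
    high_sets D A -> A = high_set c.1.1 c.1.2 c.2.
  move=> A; have [[g [m [i [_ ->]]]]|nA] := pselect (high_sets D A).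
    by exists (g, m, i).
  by exists (id, 0, 0).
have [n nP] := mkseq_separates [seq (c A).1.1 | A <- P ++ N].
pose a := \max_(A <- P ++ N) (c A).1.2.
pose t := \max_(A <- P ++ N) (c A).1.1 a.
pose S := [seq (mkseq (c A).1.1 n, (c A).1.2, (c A).2) | A <- P].
exists (enc (a, (n, (t, S)))); split=> A AX.
  rewrite (cP A); last exact: DP.
  rewrite /high_set /column /height /= encK /=; split.
  - by apply: (leq_bigmax_seq (F := fun A => (c A).1.2)); rewrite // mem_cat AX.
  - by apply: (leq_bigmax_seq (F := fun A => (c A).1.1 a)); rewrite // mem_cat AX.
  - by apply/mapP; exists A.
rewrite {1}(cP A); last exact: DN.
rewrite /high_set /column /height /= encK /= => -[_ _ /mapP[B BP [gAB mAB iAB]]].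
apply: (PN B) => //; suff -> : B = A by [].
rewrite (cP A); last exact: DN.
rewrite {1}(cP B); last exact: DP.
rewrite -mAB -iAB; congr high_set; apply/esym; apply: nP gAB;
  by apply: (map_f (fun A => (c A).1.1)); rewrite mem_cat ?BP ?AX ?orbT.
Qed.

Lemma high_sets_card_le D : infinite_set D -> high_sets D #<= D.
Proof.
move=> Dinf; apply: (card_le_trans _ (seqs_card_le Dinf)).
have /infiniteP/card_le_inj[e [eD eI]] := Dinf.
have /choice[c cP] : forall A, exists c : (nat -> nat) * nat * nat,
    high_sets D A -> D c.1.1 /\ A = high_set c.1.1 c.1.2 c.2.
  move=> A; have [[g [m [i [Dg ->]]]]|nA] := pselect (high_sets D A).
    by exists (g, m, i).
  by exists (id, 0, 0).
apply: (@inj_on_card_le _ _ _ _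
    (fun A => [:: (c A).1.1; e (c A).1.2; e (c A).2])).
  by move=> A /cP[DA _] g; rewrite !inE => /or3P[] /eqP-> //; exact: eD.
move=> A B DA DB [gE /(eI _ _ Logic.I Logic.I) mE /(eI _ _ Logic.I Logic.I) iE].
have [[_ AE] [_ BE]] := (cP A DA, cP B DB).
by rewrite AE gE mE iE -BE.
Qed.

(* For all [g] in [D] and [m], a cell of [I] meets some [high_set g m i], as only
   finitely many of these define the cell. *)
Lemma high_sets_not_ppoint D I : dominating D -> high_sets D `<=` I ->
  ~ ppoint_independent I.
Proof.
move=> Ddom DI [/independentP[Iinf Ifree] Itame].
have [E [h Ih <-]] := Itame column; have [hP hN] := FF_lists Ih.
rewrite cellE.
have meets g m : D g -> exists p i, pcell (pos h) (neg h) p /\ high_set g m i p.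
  move=> Dg.
  have [_ [i _ <-]] := exists_fresh (pos h ++ neg h)
    (@high_sets_of_infinite g m).
  rewrite mem_cat negb_or => /andP[_ iN].
  have [| | |p] := Ifree (high_set g m i :: pos h) (neg h).
  - by apply/seqs_cons; split=> //; apply: DI; exists g, m, i.
  - exact: hN.
  - by move=> A; rewrite inE => /predU1P[->|]; [exact/negP|exact: disj_pos_neg].
  by rewrite pcell_consl => -[ip hp]; exists p, i.
(* If the projection were constantly [c], a set with bound [c.+1] would still meet the cell, to the
   right of column [c]. *)
case=> [Efin|[c Ec]]; last first.
  have [g Dg _] := Ddom id.
  have [p [i [Ep [cp _ _]]]] := meets g c.+1 Dg.
  by rewrite (Ec p Ep) ltnn in cp.
(* [b] bounds the heights of the cell in each column, where it is finite; a member of [D] dominating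
   [b] gives a point of the cell above that bound. *)
have /choice[b bP] : forall a, exists b, forall p,
    pcell (pos h) (neg h) p -> column p = a -> height p <= b.
  move=> a; have /finite_seqP[s sE] := Efin a.
  exists (\max_(p <- s) height p) => p Ep pa.
  apply: (leq_bigmax_seq (F := height)) => //.
  suff : [set` s] p by []. by rewrite -sE.
have [g Dg gb] := Ddom b.
have [p [i [Ep [_ gp _]]]] := meets g 0 Dg.
have := leq_trans (leq_trans (gb (column p)) gp) (bP _ _ Ep erefl).
by rewrite ltnn.
Qed.

End HighSets.

(** * The cycle of implications between the three statements *)

Lemma continuum_le_dominating : d_eq_c ->
  forall G, dominating G -> continuum #<= G.
Proof.
move=> [F [_ Fmin] FC] G /Fmin; apply: card_le_trans.
by move: FC; rewrite card_eq_le => /andP[].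
Qed.

Lemma d_eq_c_generic : d_eq_c ->
  exist_generically everywhere_ppoint_independent.
Proof.
move=> dc I Iind /card_lt_continuum.
by apply: exists_everywhere_ppoint => // G; exact: continuum_le_dominating.
Qed.

Lemma generic_d_eq_c : exist_generically ppoint_independent -> d_eq_c.
Proof.
move=> gen; apply: contrapT => ndc.
have [D Ddom Dsmall] : exists2 D, dominating D & ~ (continuum #<= D).
  (* The set of all functions is dominating, so it would be a minimal dominating family if it
     embedded into all others. *)
  apply: contrapT => nD; apply: ndc; exists continuum => //; split.
    by move=> g; exists (fun n => (g n).+1) => // n; exact: ltnSn.
  by move=> G Gdom; apply: contrapT => nG; apply: nD; exists G.
have Dinf := dominating_infinite Ddom.
have DD := high_sets_card_le Dinf.
have nle : ~ (continuum #<= high_sets D).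
  by move=> le; apply: Dsmall; exact: card_le_trans DD.
have [||I' sub] := gen (high_sets D).
- apply/independentP; split; last exact: high_sets_free.
  have [g Dg _] := Ddom id.
  apply: sub_infinite_set (@high_sets_of_infinite g 0) => _ [i _ <-].
  by exists g, 0, i.
- split; last by rewrite card_eq_le => /andP[_ /nle].
  by case: (card_le_total continuum (high_sets D)).
exact: high_sets_not_ppoint.
Qed.

Theorem theorem2 :
  (d_eq_c <-> exist_generically everywhere_ppoint_independent) /\
  (exist_generically everywhere_ppoint_independent <->
   exist_generically ppoint_independent).
Proof.
have gen : exist_generically everywhere_ppoint_independent ->
    exist_generically ppoint_independent.
  move=> ev I Iind Ismall; have [I' II' /everywhere_ppoint] := ev I Iind Ismall.
  by exists I'.
split; split=> //.
- exact: d_eq_c_generic.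
- by move=> /gen; exact: generic_d_eq_c.
- by move=> /generic_d_eq_c; exact: d_eq_c_generic.
Qed.
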